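(* Let $X$ be a Hausdorff real locally convex topological vector space, and let $f,g:X\to\mathbb{R}\cup\{+\infty\}$ be two functions with a common domain $D:=f^{-1}(\mathbb{R})=g^{-1}(\mathbb{R})$, where $D$ is nonempty and convex. Denote by $f_D$ and $g_D$ the restrictions of $f$ and $g$ to $D$. Then the following statements are equivalent: (i) $f$ and $g$ are convex, lower semicontinuous on $D$, and $f_D-g_D$ is constant. (ii) For each $x\in D$, $$\emptyset\neq\partial_{\varepsilon}f(x)\subset\partial_{\varepsilon}g(x)\quad\text{for all }\varepsilon>0.$$ (iii) For each $x\in D$ there exists $\delta>0$ such that $$\emptyset\neq\partial_{\varepsilon}f(x)\subset\partial_{\varepsilon}g(x)\quad\text{for all }\varepsilon\in(0,\delta).$$ (iv) For each $x\in D$, $$\partial_{\varepsilon}f(x)\cap\partial_{\varepsilon}g(x)\neq\emptyset\quad\text{for all }\varepsilon>0.$$ (v) For each $x\in D$ there exists $\delta>0$ such that $$\partial_{\varepsilon}f(x)\cap\partial_{\varepsilon}g(x)\neq\emptyset\quad\text{for all }\varepsilon\in(0,\delta).$$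
   Context: $X^{*}$ is the topological dual of $X$ and $\langle\cdot,\cdot\rangle:X\times X^{*}\to\mathbb{R}$ is the duality product. For a function $\varphi:X\to\mathbb{R}\cup\{+\infty\}$, a point $x\in X$ with $\varphi(x)<+\infty$, and $\varepsilon>0$, the $\varepsilon$-subdifferential is $$\partial_{\varepsilon}\varphi(x):=\{x^{*}\in X^{*}:\ \varphi(y)-\varphi(x)\geq\langle y-x,x^{*}\rangle-\varepsilon\ \text{ for all }y\in X\}.$$ ''Lower semicontinuous on $D$'' means lower semicontinuous at every point of $D$. *)

(* Defs.v *)
From HB Require Import structures.
From mathcomp Require Import all_boot all_order all_algebra.
From mathcomp Require Import all_classical all_reals all_analysis.

Set Implicit Arguments.
Unset Strict Implicit.
Unset Printing Implicit Defensive.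

Import Order.TTheory GRing.Theory Num.Theory.
Import numFieldNormedType.Exports.

Local Open Scope classical_set_scope.
Local Open Scope ring_scope.

(* The library's [tvsType R] is a locally convex topological vector space over
   [R] that need not be Hausdorff. A function X -> R `|` {+oo} is encoded as
   [f : X -> \bar R] together with the hypothesis that [f] never takes the
   value [-oo]. *)

Definition topological_dual (R : realType) (X : tvsType R) :
    set {linear X -> R^o} :=
  [set h : {linear X -> R^o} | continuous h].

(* Only meaningful at points [x] where [phi x] is finite; the subtraction
   [phi y - phi x] is then the usual one, with value [+oo] if [phi y = +oo]. *)
Definition eps_subdifferential (R : realType) (X : tvsType R)
    (eps : R) (phi : X -> \bar R) (x : X) : set {linear X -> R^o} :=
  [set h : {linear X -> R^o} | topological_dual h /\
    forall y : X, ((h (y - x) - eps)%:E <= phi y - phi x)%E].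

Definition finite_domain (R : realType) (X : tvsType R) (f : X -> \bar R) :
    set X :=
  [set x | f x \is a fin_num].

(* The library's [convex_function] is restricted to real-valued functions.
   With [0 < t < 1] and [f] never [-oo], the right-hand side involves neither
   [0 * +oo] nor [+oo - oo]. *)
Definition convex_efunction (R : realType) (X : tvsType R)
    (f : X -> \bar R) : Prop :=
  forall (x y : X) (t : R), 0 < t -> t < 1 ->
    (f (t *: x + (1 - t) *: y)%R <= t%:E * f x + (1 - t)%:E * f y)%E.

(* The neighbourhoods are those of the whole space, also when this is required
   only at the points of a subset. *)
Definition lower_semicontinuous_at (R : realType) (X : tvsType R)
    (f : X -> \bar R) (x : X) : Prop :=
  forall a : R, (a%:E < f x)%E -> \forall y \near x, (a%:E < f y)%E.

Lemma lower_semicontinuous_atP (R : realType) (X : tvsType R)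
    (f : X -> \bar R) :
  lower_semicontinuous f <-> forall x, lower_semicontinuous_at f x.
Proof.
split=> [lf x a /lf[V xV VP]|lf x a /lf xa]; first exact: filterS xV.
by exists [set y | (a%:E < f y)%E].
Qed.

(* Main.v *)
From HB Require Import structures.
Require Import Defs.
From mathcomp Require Import all_boot all_order all_algebra.
From mathcomp Require Import all_classical all_reals all_analysis.
From mathcomp Require Import ring lra.
Import Order.TTheory GRing.Theory Num.Theory.
Import numFieldNormedType.Exports.

Set Implicit Arguments.
Unset Strict Implicit.
Unset Printing Implicit Defensive.

Local Open Scope classical_set_scope.
Local Open Scope ring_scope.

(** Two arguments are needed: one going from (i) to (ii), one from (v) back to
    (i). The implications in between only use that the eps-subdifferential
    grows with eps.

    From (i) to (ii). Adding a constant to [f] does not change its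
    eps-subdifferential, so only nonemptiness is at stake: a convex function
    that is lower semicontinuous at [x] has a continuous affine minorant whose
    value at [x] is at least [f x - eps]. This is a Hahn-Banach argument, run
    on convex cones of [X * R] instead of on partially defined functionals
    ([cone_linear_minorant]): a convex cone [K] that projects onto [X] and
    contains no [(0, c)] with [c < 0] lies above the graph of a linear map.
    By lower semicontinuity and local convexity there is a convex neighbourhood
    [W] of [0] such that [f x - eps < f (x - w)] for [w] in [W]. The cone
    generated by the epigraph of [v |-> f (x + v) - f x + eps] and by
    [W * [eps, +oo[] satisfies the hypotheses. The resulting linear map [h] is
    below the former function, which makes it an eps-subgradient, and is at
    most [eps] on [W], which makes it continuous
    ([linear_bounded_above_continuous]).

    From (v) to (i). Convexity and lower semicontinuity hold because [f] is,
    up to every [eps], supported at each point of its domain by continuous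
    affine functions. For the constancy of [f - g]
    ([diff_le_of_common_eps_subgradients]), cut the segment from [x] to [y]
    into [N] equal steps and choose at each node [p_i] a common
    [e_i]-subgradient [h_i]. Using [h_i] for [f] and [h_(i+1)] for [g] on step
    [i], the increment of [f - g] is at least
    [(h_i - h_(i+1)) (y - x) / N - e_i - e_(i+1)]. The sum over [i] telescopes
    to [(h_0 - h_N) (y - x) / N] minus the errors. The maps [h_0] and [h_N] at
    the endpoints are chosen before [N], so the first term vanishes as [N]
    grows, and the interior errors can be taken of order [1 / N]. Hence
    [f - g] is at least as large at [y] as at [x], and by symmetry it is
    constant. *)

(** * Convex sets and convex cones *)

Definition is_cone (R : realType) (V : lmodType R) (K : set V) : Prop :=
  (forall z w, K z -> K w -> K (z + w)) /\
  (forall t z, 0 <= t -> K z -> K (t *: z)).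

Definition conic_hull (R : realType) (V : lmodType R) (A : set V) : set V :=
  [set z | exists t a, [/\ 0 <= t, A a & z = t *: a]].

Lemma convex_setP (R : realType) (V : lmodType R) (A : set V) :
  convex_set A <->
  forall x y t, 0 < t -> t < 1 -> A x -> A y -> A (t *: x + (1 - t) *: y).
Proof.
rewrite convex_setW; split=> [cA x y t t0 t1 Ax Ay|cA x y].
  have t01 : Itv.spec (Itv.num_sem (R := R)) (Itv.Real `[0%Z, 1%Z]) t.
    by apply/and3P; split; rewrite ?num_real// bnd_simp ltW.
  by have /set_mem := cA _ _ (mem_set Ax) (mem_set Ay) (Itv.Def t01) t0 t1.
by rewrite !inE => Ax Ay k k0 k1; rewrite inE; exact: cA.
Qed.

Lemma convex_set_scale (R : realType) (V : lmodType R) (A : set V) (t : R)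
    (a : V) :
  convex_set A -> A 0 -> A a -> 0 <= t -> t <= 1 -> A (t *: a).
Proof.
move=> /convex_setP cA A0 Aa; rewrite le_eqVlt => /predU1P[<-|t0].
  by rewrite scale0r.
rewrite le_eqVlt => /predU1P[->|t1]; first by rewrite scale1r.
by rewrite -[_ *: _]addr0 -(scaler0 _ (1 - t)); exact: cA.
Qed.

Lemma convex_set_segment (R : realType) (V : lmodType R) (A : set V) (x y : V)
    (t : R) :
  convex_set A -> A x -> A y -> 0 <= t -> t <= 1 -> A (x + t *: (y - x)).
Proof.
move=> /convex_setP cA Ax Ay; rewrite le_eqVlt => /predU1P[<-|t0].
  by rewrite scale0r addr0.
rewrite le_eqVlt => /predU1P[->|t1]; first by rewrite scale1r addrC subrK.
have -> : x + t *: (y - x) = t *: y + (1 - t) *: x.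
  by rewrite scalerBr scalerBl scale1r addrCA.
exact: cA.
Qed.

Lemma is_cone_conic_hull (R : realType) (V : lmodType R) (A : set V) :
  convex_set A -> is_cone (conic_hull A).
Proof.
move=> /convex_setP cA; split=> [_ _ [t [a [t0 Aa ->]]] [s [b [s0 Ab ->]]]|
  s _ s0 [t [a [t0 Aa ->]]]]; last first.
  by exists (s * t), a; rewrite mulr_ge0// scalerA.
have [->|tn0] := eqVneq t 0; first by exists s, b; rewrite scale0r add0r.
have [->|sn0] := eqVneq s 0; first by exists t, a; rewrite scale0r addr0.
have tp : 0 < t by rewrite lt_neqAle eq_sym tn0.
have sp : 0 < s by rewrite lt_neqAle eq_sym sn0.
have tsp : 0 < t + s by exact: addr_gt0.
exists (t + s), ((t / (t + s)) *: a + (1 - t / (t + s)) *: b); split.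
- exact: addr_ge0.
- apply: cA => //; first exact: divr_gt0.
  by rewrite ltr_pdivrMr// mul1r ltrDl.
- rewrite scalerDr !scalerA; congr (_ *: _ + _ *: _); field; exact: lt0r_neq0.
Qed.

Lemma is_coneD (R : realType) (V : lmodType R) (K L : set V) :
  is_cone K -> is_cone L ->
  is_cone [set z | exists k l, [/\ K k, L l & z = k + l]].
Proof.
move=> [KD KZ] [LD LZ]; split.
  move=> _ _ [k [l [Kk Ll ->]]] [k' [l' [Kk' Ll' ->]]].
  by exists (k + k'), (l + l'); rewrite addrACA; split; [exact: KD|exact: LD|].
move=> t _ t0 [k [l [Kk Ll ->]]].
by exists (t *: k), (t *: l); rewrite scalerDr; split; [exact: KZ|exact: LZ|].
Qed.

(** * A Hahn-Banach theorem for cones *)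

(** The set of upper bounds [{(u, c) | q u <= c}] of a sublinear functional [q]
    is such a cone, and so is what one gets by forcing a linear minorant of [q]
    to satisfy further convex constraints; working with the cones spares the
    construction of [q].

    A maximal cone [M] above [K] under the same hypotheses contains, for every
    vector [v], a whole line spanned by some [(v, c)]: with [c] the infimum of
    the fibre of [M] over [v], the ray through [(- v, - c)] can be added to
    [M] without creating a [(0, d)] with [d < 0]. These lines form the graph of
    the linear map. *)
Lemma cone_linear_minorant (R : realType) (E : lmodType R)
    (K : set (E * R^o)%type) :
  is_cone K -> (forall c, K (0, c) -> 0 <= c) ->
  (forall u, exists c, K (u, c)) ->
  exists h : {linear E -> R^o}, forall u c, K (u, c) -> h u <= c.
Proof.
move=> Kcone K_ge0 Kdom.
(* The last condition means that [A] is empty or contains [K]: the union of the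
   empty chain, which is empty, then satisfies [P] as well. *)
pose P (A : set (E * R^o)%type) := [/\ is_cone A,
  forall c, A (0, c) -> 0 <= c & forall z, A z -> K `<=` A].
have [|M [[[MDp MZp] M_ge0 KsubM] Mmax]] := @Zorn_bigcup _ P.
  move=> F FP Ftot; split; first split.
  - move=> z w [A FA Az] [B FB Bw].
    have [AB|BA] := Ftot _ _ FA FB.
      exists B => //; have [[BD _] _ _] := FP _ FB.
      by apply: BD => //; exact: AB.
    exists A => //; have [[AD _] _ _] := FP _ FA.
    by apply: AD => //; exact: BA.
  - move=> t z t0 [A FA Az]; exists A => //.
    by have [[_ AZ] _ _] := FP _ FA; exact: AZ.
  - by move=> c [A FA Ac]; have [_ A_ge0 _] := FP _ FA; exact: A_ge0.
  - move=> z [A FA Az] y Ky; exists A => //.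
    by have [_ _ KA] := FP _ FA; exact: (KA z Az).
have KM : K `<=` M.
  have [[z Mz]|M0] := pselect (M !=set0); first exact: KsubM Mz.
  have [c0 Kc0] := Kdom 0.
  exfalso; apply: (Mmax K); last by split=> // _ _; exact: subset_refl.
  rewrite properEneq; split; last by move=> z Mz; exfalso; apply: M0; exists z.
  by apply/eqP => MK; apply: M0; exists (0, c0); rewrite MK.
have MD u a v b : M (u, a) -> M (v, b) -> M (u + v, a + b) by exact: MDp.
have MZ t u a : 0 <= t -> M (u, a) -> M (t *: u, t * a) by exact: MZp.
have Mdom u : exists c, M (u, c) by have [c /KM ?] := Kdom u; exists c.
have M0 : M 0.
  by have [c /(MZ 0 _ _ (lexx _))] := Mdom 0; rewrite scale0r mul0r.
have Mext u c : (forall a, M (u, a) -> c <= a) -> M (- u, - c).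
  move=> c_le; pose r : (E * R^o)%type := (- u, - c).
  pose B := [set z | exists m t, [/\ M m, 0 <= t & z = m + t *: r]].
  have MB : M `<=` B by move=> m Mm; exists m, 0; rewrite scale0r addr0.
  have Br : B r by exists 0, 1; rewrite scale1r add0r ler01.
  suff PB : P B by have [/(_ _ Br)//|nBM] := pselect (B `<=` M); case: (Mmax B).
  split; last by move=> _ _; exact: subset_trans MB.
  - split=> [_ _ [m [t [Mm t0 ->]]] [n [s [Mn s0 ->]]]|
      s _ s0 [m [t [Mm t0 ->]]]].
      exists (m + n), (t + s); rewrite addr_ge0//; split=> //; first exact: MDp.
      by rewrite addrACA scalerDl.
    exists (s *: m), (s * t); rewrite mulr_ge0//; split=> //; first exact: MZp.
    by rewrite scalerDr scalerA.
  - move=> d [[w a] [t [Mwa t0 [/= wE ->]]]].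
    have {}wE : w = t *: u by apply/eqP; rewrite -subr_eq0 -scalerN -wE.
    have -> : a + t *: (- c : R^o) = a - t * c by rewrite scalerN.
    rewrite subr_ge0.
    move: t0; rewrite le_eqVlt => /predU1P[t0|t0].
      by move: Mwa; rewrite wE -t0 scale0r mul0r => /M_ge0.
    rewrite -ler_pdivlMl//; apply: c_le.
    have := MZ t^-1 _ _ _ Mwa; rewrite invr_ge0 ltW// => /(_ isT).
    by rewrite wE scalerA mulVf ?gt_eqF// scale1r.
have Mray v : exists c, M (v, c) /\ M (- v, - c).
  exists (inf [set a | M (v, a)]); split.
    rewrite -[X in M (X, _)]opprK -[X in M (_, X)]opprK.
    apply: Mext => a Ma; rewrite lerNl; apply: lb_le_inf; first exact: Mdom.
    move=> b Mb; rewrite lerNl -subr_ge0 opprK addrC; apply: M_ge0.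
    by have := MD _ _ _ _ Mb Ma; rewrite addrN.
  apply: Mext => a Ma; apply: ge_inf => //.
  have [b Mb] := Mdom (- v); exists (- b) => d Md.
  rewrite -subr_ge0 opprK; apply: M_ge0.
  by have := MD _ _ _ _ Md Mb; rewrite addrN.
pose h u := xget 0 [set c | M (u, c) /\ M (- u, - c)].
have hP u : M (u, h u) /\ M (- u, - h u).
  by apply: (@xgetPex _ _ [set c | M (u, c) /\ M (- u, - c)]); exact: Mray.
have h_le u c : M (u, c) -> h u <= c.
  move=> Mc; rewrite -subr_ge0; apply: M_ge0.
  by have := MD _ _ _ _ Mc (hP u).2; rewrite addrN.
have h_uniq u c : M (u, c) -> M (- u, - c) -> h u = c.
  move=> Mc MNc; apply/eqP; rewrite eq_le h_le//= -subr_ge0; apply: M_ge0.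
  by have := MD _ _ _ _ (hP u).1 MNc; rewrite addrN.
have MhZ t u : M (t *: u, t * h u).
  have [Mu MNu] := hP u; have [t0|t0] := leP 0 t; first exact: MZ.
  by rewrite -[t]opprK scaleNr mulNr -scalerN -mulrN; apply: MZ => //;
    rewrite oppr_ge0 ltW.
have h_linear : linear (h : E -> R^o).
  move=> t u v; apply: h_uniq; first exact: MD (MhZ t u) (hP v).1.
  by rewrite !opprD -scaleNr -mulNr; exact: MD (MhZ (- t) u) (hP v).2.
pose hL : {linear E -> R^o} :=
  HB.pack (h : E -> R^o) (GRing.isLinear.Build _ _ _ _ _ h_linear).
by exists hL => u c /KM/h_le.
Qed.

(** * Topological vector spaces *)

Lemma affine_continuous (R : realType) (X : tvsType R) (c : R) (a : X) :
  continuous (fun y : X => c *: y + a).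
Proof.
move=> y.
apply: (@continuous2_cvg _ X X X _ _ _ _ (fun u v => u + v));
  [exact: (@add_continuous X (_, _))| |exact: cvg_cst].
apply: (@continuous2_cvg _ R^o X X _ _ _ _ (fun u v => u *: v));
  [exact: (@scale_continuous R X (_, _))| |exact: cvg_id].
exact: cvg_cst.
Qed.

Lemma convex_nbhs0 (R : realType) (X : tvsType R) (U : set X) : nbhs 0 U ->
  exists W : set X, [/\ nbhs 0 W, convex_set W & W `<=` U].
Proof.
have [B Bconvex [Bopen Bbasis]] := @locally_convex R X.
move=> /Bbasis [W [BW W0] WU]; exists W; split=> //.
  by apply: open_nbhs_nbhs; split=> //; exact: Bopen.
by apply: Bconvex; rewrite inE.
Qed.

Lemma nbhs0_absorbing (R : realType) (X : tvsType R) (W : set X) (u : X) :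
  nbhs 0 W -> exists2 t : R, 0 < t & W (t *: u).
Proof.
move=> W0.
have cvg0 : (fun s : R^o => s *: u) @ (0 : R^o) --> (0 : X).
  rewrite -[X in _ --> X](scale0r u).
  apply: (@continuous2_cvg _ R^o X X _ _ _ _ (fun u v => u *: v));
    [exact: (@scale_continuous R X (_, _))|exact: cvg_id|exact: cvg_cst].
have /nbhs_ballP[e /= e0 eW] := cvg0 _ W0.
exists (e / 2); first by rewrite divr_gt0.
apply: (eW (e / 2)); rewrite /ball/= sub0r normrN gtr0_norm ?divr_gt0//.
by rewrite ltr_pdivrMr// ltr_pMr// ltr1n.
Qed.

(** A one-sided bound is enough: it can be applied to both [w] and [- w], and by
    homogeneity [h] is small on a small multiple of [W]. *)
Lemma linear_bounded_above_continuous (R : realType) (X : tvsType R)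
    (h : {linear X -> R^o}) (W : set X) (M : R) :
  nbhs 0 W -> (forall w, W w -> h w <= M) -> continuous h.
Proof.
move=> W0 hM x; apply/cvgrPdist_lt => d d0.
(* [M] itself may be [0], and then could not serve as a scaling factor. *)
have M0 : 0 < M + 1.
  by rewrite ltr_wpDl// -(linear0 h) hM//; exact: nbhs_singleton.
pose c := (M + 1) / d.
have c0 : 0 < c by exact: divr_gt0.
have near_le k : \forall y \near x, W (k *: (y - x)).
  have := @affine_continuous R X k (- (k *: x)) x; rewrite /continuous_at addrN.
  by move=> /(_ _ W0) nearW; near=> y; rewrite scalerBr; near: y; exact: nearW.
near=> y.
have h_lt v : W (c *: v) -> h v < d.
  move=> /hM; rewrite linearZ/= -[X in X <= _]/(c * h v) mulrC => hv.
  have : h v * c < M + 1 by rewrite (le_lt_trans hv)// ltrDl.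
  by rewrite -ltr_pdivlMr// /c invf_div mulrC divfK// gt_eqF.
rewrite -linearB/= ltr_norml ltrNl -linearN opprB !h_lt//.
  by rewrite -opprB scalerN -scaleNr; near: y; exact: near_le.
by near: y; exact: near_le.
Unshelve. all: by end_near. Qed.

(** * Nonemptiness of the eps-subdifferential *)

Section subdifferential_nonempty.
Variables (R : realType) (X : tvsType R).
Implicit Types (f : X -> \bar R) (x y : X).

Lemma convex_efunction_le f x y (a b t : R) : convex_efunction f ->
  0 < t -> t < 1 -> (f x <= a%:E)%E -> (f y <= b%:E)%E ->
  (f (t *: x + (1 - t) *: y)%R <= (t * a + (1 - t) * b)%:E)%E.
Proof.
move=> fc t0 t1 fxa fyb; apply: (le_trans (fc _ _ _ t0 t1)).
by rewrite (EFinD (t * a)) !EFinM leeD// lee_pmul2l// lte_fin subr_gt0.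
Qed.

(** The linear map comes from the cone generated by two convex sets, [epi] and
    [cyl]: lying above [epi] is the subgradient inequality, lying above [cyl]
    is boundedness near [0]. *)
Lemma eps_subdifferential_neq0 f x (eps : R) :
  (forall y, f y != -oo%E) -> convex_efunction f -> f x \is a fin_num ->
  lower_semicontinuous_at f x -> 0 < eps ->
  eps_subdifferential eps f x !=set0.
Proof.
move=> fNy fc fxfin fxlsc eps0.
have fxE : f x = (fine (f x))%:E by rewrite fineK.
set r := fine (f x) in fxE.
have fxr : (f x <= r%:E)%E by rewrite fxE.
have [W [W0 Wc Wf]] : exists W : set X, [/\ nbhs 0 W, convex_set W &
    forall w, W w -> ((r - eps)%:E < f (x - w)%R)%E].
  have /(fxlsc _) fx_near : ((r - eps)%:E < f x)%E.
    by rewrite fxE lte_fin ltrBlDr ltrDl.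
  have cvgx : (fun w : X => -1 *: w + x) @ (0 : X) --> x.
    have := @affine_continuous R X (-1) x 0.
    by rewrite /continuous_at scaler0 add0r.
  have [W [W0 Wc Wf]] := convex_nbhs0 (cvgx _ fx_near).
  by exists W; split=> // w /Wf/=; rewrite scaleN1r (addrC _ x).
have Ww0 : W 0 by exact: nbhs_singleton.
pose epi := [set z : X * R^o | (f (x + z.1)%R <= (r - eps + z.2)%:E)%E].
pose cyl := [set z : X * R^o | W z.1 /\ eps <= z.2].
have epi_convex : convex_set epi.
  apply/convex_setP => -[v a] [w b] t t0 t1 /= fa fb.
  rewrite /epi/=.
  have -> : x + (t *: v + (1 - t) *: w) = t *: (x + v) + (1 - t) *: (x + w).
    by rewrite !scalerDr addrACA -scalerDl (addrC t) subrK scale1r.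
  apply: le_trans (convex_efunction_le fc t0 t1 fa fb) _.
  rewrite lee_fin /GRing.scale/= le_eqVlt; apply/orP; left; apply/eqP; ring.
have cyl_convex : convex_set cyl.
  apply/convex_setP => -[v a] [w b] t t0 t1 [/= Wv ea] [/= Ww eb].
  split=> /=; first by move/convex_setP: Wc; exact.
  rewrite /GRing.scale/=; nra.
have Kcone := is_coneD (is_cone_conic_hull epi_convex)
  (is_cone_conic_hull cyl_convex).
have epi0 : epi (0, eps) by rewrite /epi/= addr0 subrK.
have cyl0 : cyl (0, eps) by split=> /=.
have [||h hK] := cone_linear_minorant Kcone.
- move=> c [_ [_ [[t [[v a] [t0 epia ->]]] [s [[w b] [s0 [/= Ww eb] ->]]] []]]].
  move=> /esym/eqP; rewrite -/(t *: v) -/(s *: w) addr_eq0 => /eqP tv ->.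
  rewrite /GRing.scale/=.
  (* From [t *: v + s *: w = 0], [t * a + s * b] has to be shown nonnegative. *)
  have [->|tn0] := eqVneq t 0.
    by rewrite mul0r add0r mulr_ge0// (le_trans _ eb)// ltW.
  have tp : 0 < t by rewrite lt_neqAle eq_sym tn0.
  have vE : v = - ((s / t) *: w).
    apply: (scalerI tn0); rewrite tv scalerN scalerA; congr (- (_ *: _)).
    by field; exact: tn0.
  have [st|st] := leP s t.
    (* Here [- v] is a convex combination of [0] and [w], hence in [W]. *)
    have /Wf : W ((s / t) *: w).
      by apply: convex_set_scale => //; rewrite ?divr_ge0// ler_pdivrMr// mul1r.
    rewrite -vE => /lt_le_trans/(_ epia); rewrite lte_fin ltrDl /= => a0.
    by rewrite addr_ge0// mulr_ge0 ?(ltW a0)// (le_trans _ eb)// ltW.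
  (* Here [x - w] lies between [x] and [x + v], and convexity transfers the
     lower bound of [f] at [x - w] to [x + v]. *)
  have sp : 0 < s by exact: lt_trans st.
  have : (f (x - w)%R <= ((t / s) * (r - eps + a) + (1 - t / s) * r)%:E)%E.
    have -> : x - w = (t / s) *: (x + v) + (1 - t / s) *: x.
      rewrite scalerDr scalerBl scale1r vE scalerN scalerA.
      have -> : t / s * (s / t) = 1 by field; rewrite tn0 gt_eqF.
      by rewrite scale1r addrAC [(t / s) *: x + _]addrC subrK.
    by apply: convex_efunction_le; rewrite ?divr_gt0// ltr_pdivrMr// mul1r.
  move=> /(lt_le_trans (Wf _ Ww)); rewrite lte_fin -(ltr_pM2l sp).
  have -> : s * ((t / s) * (r - eps + a) + (1 - t / s) * r) =
      s * r - t * eps + t * a by field; rewrite gt_eqF.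
  nra.
- move=> u; have [t t0 Wtu] := nbhs0_absorbing u W0.
  exists (t^-1 * eps); exists (0 *: (0, eps)), (t^-1 *: (t *: u, eps)); split.
  + by exists 0, (0, eps).
  + by exists t^-1, (t *: u, eps); rewrite invr_ge0 ltW//; split.
  + rewrite scale0r add0r; congr (_, _).
    by rewrite /= scalerA mulVf ?gt_eqF// scale1r.
have hepi z : epi z -> h z.1 <= z.2.
  move=> epiz; apply: hK; exists (1 *: z), (0 *: (0, eps)); split.
  + by exists 1, z.
  + by exists 0, (0, eps).
  + by rewrite scale1r scale0r addr0; case: z {epiz}.
have hcyl w : W w -> h w <= eps.
  move=> Ww; apply: hK; exists (0 *: (0, eps)), (1 *: (w, eps)); split.
  + by exists 0, (0, eps).
  + by exists 1, (w, eps); split=> //; split.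
  + by rewrite scale1r scale0r add0r.
exists h; split; first exact: linear_bounded_above_continuous W0 hcyl.
move=> y; rewrite fxE.
move: (fNy y) (hepi (y - x, fine (f y) - r + eps)).
rewrite /epi/= [x + _]addrC subrK.
case: (f y) => [b _|_ _|//]; last by rewrite leey.
rewrite /= -EFinB !lee_fin lerBlDr; apply.
by rewrite (_ : r - eps + (b - r + eps) = b)//; ring.
Qed.
End subdifferential_nonempty.

(** * Properties of the eps-subdifferential *)

Lemma eps_subdifferentialP (R : realType) (X : tvsType R) (f : X -> \bar R)
    (x : X) (eps : R) (h : {linear X -> R^o}) :
  (forall y, f y != -oo%E) -> finite_domain f x ->
  eps_subdifferential eps f x h <-> topological_dual h /\
    forall y, finite_domain f y -> h (y - x) - eps <= fine (f y) - fine (f x).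
Proof.
rewrite /finite_domain/= => fNy fx; split=> -[hc hf]; split=> // y.
  by move=> fy; have := hf y; rewrite -(fineK fx) -(fineK fy) -EFinB lee_fin.
have [fy|] := boolP (f y \is a fin_num).
  by rewrite -(fineK fx) -(fineK fy) -EFinB lee_fin; exact: hf.
rewrite fin_numE negb_and (fNy y)/= negbK => /eqP ->.
by rewrite -(fineK fx) leey.
Qed.

Lemma eps_subdifferential_le (R : realType) (X : tvsType R) (f : X -> \bar R)
    (x : X) (e d : R) : e <= d ->
  eps_subdifferential e f x `<=` eps_subdifferential d f x.
Proof.
move=> ed h [hc hf]; split=> // y; apply: le_trans (hf y).
by rewrite lee_fin lerB.
Qed.

Section finite_domain_facts.
Variables (R : realType) (X : tvsType R).
Implicit Types (f g : X -> \bar R) (x y : X).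

Lemma eps_subdifferential_translate f g x (eps c : R) :
  (forall y, f y != -oo%E) -> (forall y, g y != -oo%E) ->
  finite_domain f = finite_domain g -> finite_domain f x ->
  (forall y, finite_domain f y -> (f y - g y)%E = c%:E) ->
  eps_subdifferential eps f x `<=` eps_subdifferential eps g x.
Proof.
move=> fN gN fg fx fgc h /(eps_subdifferentialP _ _ fN fx) [hc hf].
apply/(eps_subdifferentialP _ _ gN); first by rewrite -fg.
split=> // y; rewrite -fg => fy.
have fE z : finite_domain f z -> fine (f z) = fine (g z) + c.
  move=> fz; have gz : finite_domain g z by rewrite -fg.
  have := fgc _ fz; rewrite -(fineK fz) -(fineK gz) -EFinB => -[] <-.
  by rewrite addrC subrK.
by move: (hf _ fy); rewrite (fE _ fx) (fE _ fy) opprD addrACA addrN addr0.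
Qed.

(** At the intermediate point [z], an eps-subgradient [h] gives lower bounds for
    [f x] and [f y]; in their convex combination [h] cancels, since [z] is the
    barycentre. *)
Lemma convex_of_eps_subdifferential f :
  (forall y, f y != -oo%E) -> convex_set (finite_domain f) ->
  (forall x, finite_domain f x ->
    forall eps : R, 0 < eps -> eps_subdifferential eps f x !=set0) ->
  convex_efunction f.
Proof.
move=> fN /convex_setP fc fsub x y t t0 t1.
have t1' : 0 < 1 - t by rewrite subr_gt0.
have [fx|] := boolP (f x \is a fin_num); last first.
  rewrite fin_numE negb_and (fN x)/= negbK => /eqP ->.
  rewrite gt0_muley ?lte_fin// addye ?leey//.
  by case: (f y) (fN y) => // _; rewrite gt0_muley ?lte_fin.
have [fy|] := boolP (f y \is a fin_num); last first.
  rewrite fin_numE negb_and (fN y)/= negbK => /eqP ->.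
  rewrite gt0_muley ?lte_fin// addey ?leey//.
  by rewrite -(fineK fx).
have fz : finite_domain f (t *: x + (1 - t) *: y) by exact: fc.
rewrite -(fineK fx) -(fineK fy) -(fineK fz) -!EFinM -EFinD lee_fin.
apply/ler_addgt0Pr => e e0.
have [h /(eps_subdifferentialP _ _ fN fz)[_ hf]] := fsub _ fz _ e0.
have := hf _ fx; have := hf _ fy.
set z := t *: x + (1 - t) *: y.
have hz : (h (x - z) : R) * t + (h (y - z) : R) * (1 - t) = 0.
  pose k : R := h (x - y).
  have -> : (h (x - z) : R) = (1 - t) * k.
    transitivity (h ((1 - t) *: (x - y))); last by rewrite linearZ.
    by rewrite /z opprD addrA -{1}[x]scale1r -scalerBl scalerBr.
  have -> : (h (y - z) : R) = - t * k.
    transitivity (h (- t *: (x - y))); last by rewrite linearZ.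
    congr (h _); rewrite /z scaleNr scalerBl scale1r scalerBr !opprD !opprK.
    by rewrite addrCA [y + _]addrA addrN add0r.
  ring.
move: hz; move: (h (x - z) : R) (h (y - z) : R) => u v; nra.
Qed.

(** Below the graph of [f] lies a continuous affine function that is within
    [eps] of [f] at [x]. *)
Lemma lower_semicontinuous_of_eps_subdifferential f x :
  (forall y, f y != -oo%E) -> finite_domain f x ->
  (forall eps : R, 0 < eps -> eps_subdifferential eps f x !=set0) ->
  lower_semicontinuous_at f x.
Proof.
move=> fN fx fsub a; rewrite -(fineK fx) lte_fin -subr_gt0 => afx.
set e := (fine (f x) - a) / 2.
have e0 : 0 < e by rewrite divr_gt0.
have [h [hc hf]] := fsub _ e0.
have := hc x; move=> /cvgrPdist_lt /(_ _ e0) hnear.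
near=> y.
have : `|h x - h y| < e by near: y.
rewrite ltr_norml => /andP[_ hxy].
have hyx : (h (y - x) : R) > - e by rewrite linearB ltrNl opprB.
have := hf y; rewrite -(fineK fx).
case: (f y) (fN y) => [r _|_ _|//]; last by rewrite ltry.
rewrite -EFinB lee_fin lte_fin => hr.
have aux (v F : R) : - ((F - a) / 2) < v -> v - (F - a) / 2 <= r - F -> a < r.
  by move=> ? ?; lra.
exact: aux hyx hr.
Unshelve. all: by end_near. Qed.
End finite_domain_facts.

(** * Functions with common approximate subgradients *)

Section common_eps_subgradients.
(* The casts to [R] below keep the terms in the ring [R], where the arithmetic
   decision procedures apply, rather than in the module [R^o]. *)
Variables (R : realType) (V : lmodType R) (D : set V) (F G : V -> R).
Hypothesis D_convex : convex_set D.
Hypothesis common_subgradient : forall x eps, D x -> 0 < eps ->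
  exists h : {linear V -> R^o}, forall y, D y ->
    (h (y - x) : R) - eps <= F y - F x /\
      (h (y - x) : R) - eps <= G y - G x.

(** The eps-subgradients at [x] and at [y] may be unbounded as [eps] decreases,
    so comparing [x] and [y] in one step does not suffice. With the
    subgradients at [x] and [y] fixed, a subdivision into [N] steps makes them
    contribute only in the ratio [1 / N], and those at the interior nodes
    cancel whatever their size. *)
Lemma diff_le_of_common_eps_subgradients x y :
  D x -> D y -> F x - G x <= F y - G y.
Proof.
move=> Dx Dy; apply/ler_addgt0Pr => eta eta0.
(* At the end, the slopes cost [e0] and each of the two error sums [2 * e0]. *)
pose e0 := eta / 5.
have e00 : 0 < e0 by rewrite divr_gt0.
have [hx hxP] := common_subgradient Dx e00.
have [hy hyP] := common_subgradient Dy e00.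
pose d := y - x.
have [n nP] : exists n : nat, (hy d - hx d : R) / n.+1%:R <= e0.
  exists (Num.truncn (`|hy d - hx d| / e0)).
  rewrite ler_pdivrMr// mulrC -ler_pdivrMr//.
  apply: (le_trans _ (ltW (truncnS_gt _))).
  by apply: ler_wpM2r; [rewrite invr_ge0 ltW|exact: ler_norm].
pose N : R := n.+1%:R.
have N0 : 0 < N by rewrite ltr0n.
pose p (i : nat) : V := x + (i%:R / N) *: d.
have p0 : p 0 = x by rewrite /p mul0r scale0r addr0.
have pn : p n.+1 = y by rewrite /p divff ?gt_eqF// scale1r addrC subrK.
pose e (i : nat) : R := if (i == 0)%N || (i == n.+1) then e0 else e0 / N.
have Dp i : (i <= n.+1)%N -> D (p i).
  move=> ile; apply: convex_set_segment => //; first by rewrite divr_ge0// ltW.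
  by rewrite ler_pdivrMr// mul1r ler_nat.
have [h hP] : exists h : nat -> {linear V -> R^o}, [/\ h 0 = hx, h n.+1 = hy &
    forall i z, (i <= n.+1)%N -> D z ->
    (h i (z - p i) : R) - e i <= F z - F (p i) /\
    (h i (z - p i) : R) - e i <= G z - G (p i)].
  suff /choice [h hP] : forall i, exists h : {linear V -> R^o},
      [/\ (i = 0 -> h = hx)%N, (i = n.+1 -> h = hy) &
        (i <= n.+1)%N -> forall z, D z ->
        (h (z - p i) : R) - e i <= F z - F (p i) /\
        (h (z - p i) : R) - e i <= G z - G (p i)].
    exists h; split; first by case: (hP 0) => /(_ erefl).
      by case: (hP n.+1) => _ /(_ erefl).
    by move=> i z ile Dz; case: (hP i) => _ _ /(_ ile _ Dz).
  move=> i; have [->|i0] := eqVneq i 0; first by exists hx; rewrite p0 /e/=.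
  have [->|iN] := eqVneq i n.+1; first by exists hy; rewrite pn /e/= eqxx.
  have [ile|igt] := leqP i n.+1; last first.
    by exists hx; split=> //; move/eqP; rewrite (negbTE iN).
  have [h hP] := common_subgradient (Dp _ ile) (divr_gt0 e00 N0).
  exists h; split; first by move/eqP; rewrite (negbTE i0).
    by move/eqP; rewrite (negbTE iN).
  by move=> _ z Dz; rewrite /e (negbTE i0) (negbTE iN)/=; exact: hP.
have [h0 hn {}hP] := hP.
pose H (i : nat) : R := h i d.
have step i : (i < n.+1)%N ->
    (H i - H i.+1) / N - (e i + e i.+1) <=
    (F (p i.+1) - G (p i.+1)) - (F (p i) - G (p i)).
  move=> ilt.
  have pE : p i.+1 - p i = N^-1 *: d.
    rewrite /p opprD addrACA addrN add0r -scalerBl -mulrBl; congr (_ *: _).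
    by rewrite -natrB// subSnn mul1r.
  have [hF _] := hP i _ (ltnW ilt) (Dp _ ilt).
  have [_ hG] := hP i.+1 _ ilt (Dp _ (ltnW ilt)).
  have hE j : (h j (p i.+1 - p i) : R) = H j / N by rewrite pE linearZ mulrC.
  have {}hF : H i / N - e i <= F (p i.+1) - F (p i) by rewrite -hE.
  have {}hG : - (H i.+1 / N) - e i.+1 <= G (p i) - G (p i.+1).
    by rewrite -hE -linearN opprB.
  rewrite mulrBl; move: hF hG; rewrite -/N.
  have aux (a b u v A B A' B' : R) : a - u <= B - A -> - b - v <= A' - B' ->
    a - b - (u + v) <= (B - B') - (A - A') by lra.
  exact: aux.
have sum_step :
    \sum_(0 <= i < n.+1) ((H i - H i.+1) / N - (e i + e i.+1)) <=
    (F y - G y) - (F x - G x).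
  rewrite -p0 -pn -(telescope_sumr (fun i => F (p i) - G (p i)))//.
  by apply: ler_sum_nat => i /andP[_ ilt]; exact: step.
have sum_e : \sum_(0 <= i < n.+1) e i <= e0 *+ 2 /\
    \sum_(0 <= i < n.+1) e i.+1 <= e0 *+ 2.
  have sum_inner : \sum_(0 <= i < n) e i.+1 <= e0.
    rewrite (@eq_big_nat _ _ _ _ _ _ (fun=> e0 / N)); last first.
      by move=> i /andP[_ ilt]; rewrite /e eqSS (ltn_eqF ilt).
    rewrite sumr_const_nat subn0 -mulr_natr mulrAC -mulrA ger_pMr//.
    by rewrite ler_pdivrMr// mul1r ler_nat.
  by rewrite big_nat_recl// big_nat_recr//= /e !eqxx orbT !mulr2n lerD2l lerD2r.
have sum_h : \sum_(0 <= i < n.+1) (H i - H i.+1) = H 0 - H n.+1.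
  rewrite -[RHS]opprB -(telescope_sumr H)// -sumrN.
  by apply: eq_bigr => i _; rewrite opprB.
rewrite sumrB -mulr_suml sum_h big_split/= in sum_step.
have hN : (H n.+1 - H 0) / N <= e0 by rewrite /H hn h0.
have etaE : eta = e0 * 5 by rewrite /e0 divfK// pnatr_eq0.
rewrite -(opprB (H n.+1)) mulNr in sum_step.
have aux (a S T A B : R) : a <= e0 -> S <= e0 *+ 2 -> T <= e0 *+ 2 ->
  - a - (S + T) <= B - A -> A <= B + eta by lra.
by case: sum_e => S_le T_le; exact: aux hN S_le T_le sum_step.
Qed.
End common_eps_subgradients.

(** * The equivalence *)

Theorem corollary2 (R : realType) (X : tvsType R) (hX : hausdorff_space X)
    (f g : X -> \bar R)
    (hf : forall x, f x != -oo%E) (hg : forall x, g x != -oo%E)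
    (D : set X) (hfD : D = finite_domain f) (hgD : D = finite_domain g)
    (hD0 : D !=set0) (hDc : convex_set D) :
  [<->
    (* (i) *)
    [/\ convex_efunction f, convex_efunction g,
        (forall x, D x -> lower_semicontinuous_at f x),
        (forall x, D x -> lower_semicontinuous_at g x) &
        exists c : R, forall x, D x -> (f x - g x)%E = c%:E];
    (* (ii) *)
    forall x, D x -> forall eps : R, 0 < eps ->
      eps_subdifferential eps f x !=set0 /\
      eps_subdifferential eps f x `<=` eps_subdifferential eps g x;
    (* (iii) *)
    forall x, D x -> exists2 delta : R, 0 < delta &
      forall eps : R, 0 < eps -> eps < delta ->
        eps_subdifferential eps f x !=set0 /\
        eps_subdifferential eps f x `<=` eps_subdifferential eps g x;
    (* (iv) *)
    forall x, D x -> forall eps : R, 0 < eps ->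
      eps_subdifferential eps f x `&` eps_subdifferential eps g x !=set0;
    (* (v) *)
    forall x, D x -> exists2 delta : R, 0 < delta &
      forall eps : R, 0 < eps -> eps < delta ->
        eps_subdifferential eps f x `&` eps_subdifferential eps g x !=set0].
Proof.
have fgD : finite_domain f = finite_domain g by rewrite -hfD.
have exists_small (eps d : R) : 0 < eps -> 0 < d ->
    exists e, [/\ 0 < e, e < d & e <= eps].
  move=> eps0 d0; exists (Num.min eps (d / 2)).
  rewrite lt_min gt_min ge_min eps0 lexx divr_gt0// ltr_pdivrMr// ltr_pMr//.
  by rewrite ltr1n orbT.
tfae.
- move=> [fc gc flsc glsc [c fgc]] x Dx eps eps0; split.
    apply: eps_subdifferential_neq0 => //; last exact: flsc.
    by move: Dx; rewrite hfD.
  by apply: (@eps_subdifferential_translate _ _ _ _ _ _ c); rewrite -?hfD.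
- by move=> fg x Dx; exists 1 => // eps eps0 _; exact: fg.
- move=> fg x Dx eps eps0; have [d d0 fgd] := fg x Dx.
  have [e [e0 e_lt le_eps]] := exists_small _ _ eps0 d0.
  have [[h hfx] fsubg] := fgd e e0 e_lt.
  exists h; split; apply: (eps_subdifferential_le le_eps) => //.
  exact: fsubg.
- by move=> fg x Dx; exists 1 => // eps eps0 _; exact: fg.
move=> fg_lt.
have fg x eps : D x -> 0 < eps ->
    exists h, eps_subdifferential eps f x h /\ eps_subdifferential eps g x h.
  move=> Dx eps0; have [d d0 fgd] := fg_lt x Dx.
  have [e [e0 e_lt le_eps]] := exists_small _ _ eps0 d0.
  have [h [hfx hgx]] := fgd e e0 e_lt.
  by exists h; split; exact: (eps_subdifferential_le le_eps).
have fne x : D x -> forall eps, 0 < eps -> eps_subdifferential eps f x !=set0.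
  by move=> Dx eps /(fg _ _ Dx)[h [hfx _]]; exists h.
have gne x : D x -> forall eps, 0 < eps -> eps_subdifferential eps g x !=set0.
  by move=> Dx eps /(fg _ _ Dx)[h [_ hgx]]; exists h.
split.
- by apply: convex_of_eps_subdifferential; rewrite -?hfD.
- by apply: convex_of_eps_subdifferential; rewrite -?hgD.
- move=> x Dx; apply: lower_semicontinuous_of_eps_subdifferential;
    by rewrite -?hfD//; exact: fne.
- move=> x Dx; apply: lower_semicontinuous_of_eps_subdifferential;
    by rewrite -?hgD//; exact: gne.
have diff_le x y : D x -> D y ->
    fine (f x) - fine (g x) <= fine (f y) - fine (g y).
  apply: (diff_le_of_common_eps_subgradients (F := fine \o f)
    (G := fine \o g) hDc) => {}x eps Dx eps0.
  have [h [hf' hg']] := fg x eps Dx eps0.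
  exists h => {}y Dy.
  have fx : finite_domain f x by rewrite -hfD.
  have gx : finite_domain g x by rewrite -hgD.
  have /(eps_subdifferentialP _ _ hf fx)[_ hfx] := hf'.
  have /(eps_subdifferentialP _ _ hg gx)[_ hgx] := hg'.
  by split; [apply: hfx; rewrite -hfD|apply: hgx; rewrite -hgD].
have [x0 Dx0] := hD0.
exists (fine (f x0) - fine (g x0)) => x Dx.
have fx : f x \is a fin_num by move: Dx; rewrite hfD.
have gx : g x \is a fin_num by move: Dx; rewrite hgD.
rewrite -(fineK fx) -(fineK gx) -EFinB; congr EFin.
by apply/eqP; rewrite eq_le !diff_le.
Qed.
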